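(* Let $n\ge 2$ and let $G \subsetneq \mathbb{R}^n$ be a domain. Then there exist $x,y\in G$ such that there is no geodesic $J[x,y]$ of the $j$-metric $j_G$ between $x$ and $y$.
   Context: Let $n\ge 2$ and let $G\subsetneq\mathbb{R}^n$ be a domain (a nonempty open connected set). For $x\in G$ let $d(x)$ denote the Euclidean distance from $x$ to $\partial G$. The $j$-metric on $G$ is $$j_G(x,y)=\log\left(1+\frac{|x-y|}{\min\{d(x),d(y)\}}\right),\qquad x,y\in G.$$ A curve $\gamma$ in $G$ is called a geodesic segment, or geodesic (of $j_G$), if $j_G(x,y)+j_G(y,z)=j_G(x,z)$ for all $x,z\in\gamma$ and all $y\in\gamma'$, where $\gamma'$ is the subcurve of $\gamma$ joining $x$ and $z$. A geodesic joining $x$ and $y$ is denoted $J[x,y]$. *)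

(* Defs.v *)
From HB Require Import structures.
From mathcomp Require Import all_boot all_order all_algebra.
From mathcomp Require Import all_classical all_reals all_analysis.

Set Implicit Arguments.
Unset Strict Implicit.
Unset Printing Implicit Defensive.

Import Order.TTheory GRing.Theory Num.Theory.
Import numFieldNormedType.Exports.

Local Open Scope classical_set_scope.
Local Open Scope ring_scope.

(* R^n is 'rV[R]_n, whose library topology is the usual one. The library norm
   `|v| on matrices is the sup norm, hence the explicit Euclidean norm. *)
Definition enorm (R : realType) (n : nat) (v : 'rV[R]_n) : R :=
  Num.sqrt (\sum_(i < n) v ord0 i ^+ 2).

Definition boundary (T : topologicalType) (A : set T) : set T :=
  closure A `\` interior A.

Definition domain (T : topologicalType) (A : set T) : Prop :=
  [/\ A !=set0, open A & connected A].

(* The infimum is over a nonempty set (and so is the genuine one) whenever G is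
   neither empty nor the whole space. *)
Definition dist_boundary (R : realType) (n : nat) (G : set 'rV[R]_n)
    (x : 'rV[R]_n) : R :=
  inf [set enorm (x - z) | z in boundary G].

Definition j_metric (R : realType) (n : nat) (G : set 'rV[R]_n)
    (x y : 'rV[R]_n) : R :=
  ln (1 + enorm (x - y) / Num.min (dist_boundary G x) (dist_boundary G y)).

(* Curves are parametrized by [0, 1]; only the values there matter. *)
Definition curve_in (R : realType) (n : nat) (G : set 'rV[R]_n)
    (gamma : R -> 'rV[R]_n) : Prop :=
  {within `[0, 1], continuous gamma} /\ gamma @` `[0, 1] `<=` G.

(* The subcurve joining gamma s and gamma u, s <= u, is gamma on [s, u]; since
   j_metric is symmetric, the order of the two endpoints is immaterial. *)
Definition j_geodesic (R : realType) (n : nat) (G : set 'rV[R]_n)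
    (gamma : R -> 'rV[R]_n) : Prop :=
  curve_in G gamma /\
  forall s t u : R, 0 <= s -> s <= t -> t <= u -> u <= 1 ->
    j_metric G (gamma s) (gamma t) + j_metric G (gamma t) (gamma u)
      = j_metric G (gamma s) (gamma u).

Definition j_geodesic_joining (R : realType) (n : nat) (G : set 'rV[R]_n)
    (x y : 'rV[R]_n) (gamma : R -> 'rV[R]_n) : Prop :=
  [/\ j_geodesic G gamma, gamma 0 = x & gamma 1 = y].

(* Main.v *)
Require Import Defs.
From HB Require Import structures.
From mathcomp Require Import all_boot all_order all_algebra.
From mathcomp Require Import all_classical all_reals all_analysis.
From mathcomp Require Import ring lra.

Import Order.TTheory GRing.Theory Num.Theory.
Import numFieldNormedType.Exports.

Local Open Scope classical_set_scope.
Local Open Scope ring_scope.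

(** Write [d x] for the distance from [x] to the boundary of [G]. Existence of
    a geodesic from [x] to [z] forces [|d x - d z| = |x - z|]: if [d x <= d z],
    additivity of [j] at a point [y <> z] of the curve, once exponentiated,
    gives [d x + |x - y| <= d z] ([j_additive_dist]), and [y] may be chosen
    arbitrarily close to [z] by continuity of the curve ([j_geodesic_dist]).
    Thus, if all pairs of points were joined by geodesics, [d] would be a
    distance-preserving map from an open subset of R^n to the line. In
    dimension at least 2 there is none: the legs of a small right isosceles
    triangle would be mapped to numbers [u], [v] with [u^2 = v^2 = s^2] and
    [(u + v)^2 = 2 s^2], so that [u v = 0] and [s = 0]
    ([open_no_isometry]).

    The infimum defining [d] behaves as a distance because the boundary is
    nonempty ([boundary_nonempty]), by connectedness of segments; then [d] is
    1-Lipschitz, and positive on [G]. *)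

(** * The Euclidean norm *)

Lemma enorm_ge0 {R : realType} {n : nat} (v : 'rV[R]_n) : 0 <= enorm v.
Proof. exact: sqrtr_ge0. Qed.

Lemma sqr_enorm {R : realType} {n : nat} (v : 'rV[R]_n) :
  enorm v ^+ 2 = \sum_(i < n) v ord0 i ^+ 2.
Proof. by rewrite sqr_sqrtr // sumr_ge0 // => i _; exact: sqr_ge0. Qed.

Lemma enorm0 {R : realType} {n : nat} : enorm (0 : 'rV[R]_n) = 0.
Proof.
by rewrite /enorm big1 ?sqrtr0 // => i _; rewrite mxE expr0n.
Qed.

Lemma enormN {R : realType} {n : nat} (v : 'rV[R]_n) : enorm (- v) = enorm v.
Proof. by rewrite /enorm; under eq_bigr do rewrite mxE sqrrN. Qed.

Lemma enormBC {R : realType} {n : nat} (v w : 'rV[R]_n) :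
  enorm (v - w) = enorm (w - v).
Proof. by rewrite -enormN opprB. Qed.

Lemma norm_coord_le_enorm {R : realType} {n : nat} (v : 'rV[R]_n) i :
  `|v ord0 i| <= enorm v.
Proof.
rewrite -(@ler_pXn2r _ 2) ?nnegrE ?enorm_ge0 // real_normK ?num_real //.
rewrite sqr_enorm (bigD1 i) //= lerDl sumr_ge0 // => j _; exact: sqr_ge0.
Qed.

Lemma enorm_eq0 {R : realType} {n : nat} (v : 'rV[R]_n) : enorm v = 0 -> v = 0.
Proof.
move=> v0; apply/rowP => i; rewrite mxE; apply/eqP.
by rewrite -normr_le0 -v0 norm_coord_le_enorm.
Qed.

(** The sum of the squares of the coordinates of [|w| v - |v| w] is
    [2 |v| |w| (|v| |w| - <v, w>)]. *)
Lemma cauchy_schwarz {R : realType} {n : nat} (v w : 'rV[R]_n) :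
  \sum_(i < n) v ord0 i * w ord0 i <= enorm v * enorm w.
Proof.
have [v0|v0] := eqVneq (enorm v) 0.
  by rewrite v0 mul0r (enorm_eq0 _ v0) big1 // => i _; rewrite mxE mul0r.
have [w0|w0] := eqVneq (enorm w) 0.
  by rewrite w0 mulr0 (enorm_eq0 _ w0) big1 // => i _; rewrite mxE mulr0.
set S := \sum_(i < n) _.
have /eqP E : \sum_(i < n) (enorm w * v ord0 i - enorm v * w ord0 i) ^+ 2
    = 2 * (enorm v * enorm w) * (enorm v * enorm w - S).
  transitivity (enorm w ^+ 2 * (\sum_(i < n) v ord0 i ^+ 2)
     - 2 * (enorm v * enorm w) * S + enorm v ^+ 2 * \sum_(i < n) w ord0 i ^+ 2).
    rewrite !mulr_sumr -sumrB -big_split /=.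
    by apply: eq_bigr => i _; ring.
  by rewrite -!sqr_enorm; ring.
have vw0 : 0 < 2 * (enorm v * enorm w).
  by rewrite !mulr_gt0 // lt0r ?v0 ?w0 enorm_ge0.
rewrite -subr_ge0 -(pmulr_rge0 _ vw0) -(eqP E).
by rewrite sumr_ge0 // => i _; exact: sqr_ge0.
Qed.

Lemma ler_enormD {R : realType} {n : nat} (v w : 'rV[R]_n) :
  enorm (v + w) <= enorm v + enorm w.
Proof.
rewrite -(@ler_pXn2r _ 2) ?nnegrE ?addr_ge0 ?enorm_ge0 //.
have -> : enorm (v + w) ^+ 2
    = enorm v ^+ 2 + enorm w ^+ 2 + 2 * \sum_(i < n) v ord0 i * w ord0 i.
  rewrite !sqr_enorm mulr_sumr -!big_split /=.
  by apply: eq_bigr => i _; rewrite mxE; ring.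
have := cauchy_schwarz v w; lra.
Qed.

Lemma enorm_triangle {R : realType} {n : nat} (x y z : 'rV[R]_n) :
  enorm (x - z) <= enorm (x - y) + enorm (y - z).
Proof. by rewrite -(subrKA y); exact: ler_enormD. Qed.

Lemma mx_norm_le_enorm {R : realType} {n : nat} (v : 'rV[R]_n) :
  `|v| <= enorm v.
Proof.
rewrite [`|v|]mx_normrE; apply: bigmax_le => [|[i j] _]; first exact: enorm_ge0.
by rewrite /= (ord1 i); exact: norm_coord_le_enorm.
Qed.

Lemma enorm_continuous {R : realType} {n : nat} :
  continuous (@enorm R n).
Proof.
move=> v; apply: (@continuous_comp _ _ _ _ Num.sqrt);
  last exact: sqrt_continuous.
apply: continuous_big => [|i _]; first exact: add_continuous.
move=> w; apply: (@continuous_comp _ _ _ (fun u : 'rV[R]_n => u ord0 i)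
  (fun r => r ^+ 2)).
  exact: coord_continuous.
exact: exprn_continuous.
Qed.

Lemma enorm_delta2 {R : realType} {n : nat} (i j : 'I_n) (s t : R) : i != j ->
  enorm (s *: delta_mx ord0 i - t *: delta_mx ord0 j) ^+ 2 = s ^+ 2 + t ^+ 2.
Proof.
move=> ij; rewrite sqr_enorm (bigD1 i) //= (bigD1 j) 1?eq_sym //= big1 ?addr0.
  by rewrite !mxE !eqxx (negPf ij) eq_sym (negPf ij) /=; ring.
by move=> k /andP[/negPf ki /negPf kj]; rewrite !mxE ki kj /=; ring.
Qed.

(** * The distance to the boundary *)

(** Without boundary points [G] would be both open and closed, so a segment
    starting in [G] could not leave it. *)
Lemma boundary_nonempty {R : realType} {n : nat} (G : set 'rV[R]_n) :
  open G -> G !=set0 -> G != setT -> boundary G !=set0.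
Proof.
move=> oG [x Gx] /eqP GT; apply/set0P/eqP => bG0; apply: GT.
have cG : closed G.
  move=> w cw; apply: contrapT => nGw.
  have : boundary G w by split=> // /interior_subset.
  by rewrite bG0.
apply/seteqP; split=> // z _.
pose f (t : R) : 'rV[R]_n := x + t *: (z - x).
have cf : continuous f.
  by move=> t; apply: cvgD; [exact: cvg_cst | apply: cvgZr_tmp; exact: cvg_id].
have cA : connected (f @` `[0, 1]).
  apply: connected_continuous_connected; first exact: segment_connected.
  exact: continuous_subspaceT.
have fx : (f @` `[0, 1]) x.
  by exists 0; rewrite /f ?scale0r ?addr0 //= in_itv /= lexx ler01.
have fz : (f @` `[0, 1]) z.
  by exists 1; rewrite /f ?scale1r ?subrKC //= in_itv /= lexx ler01.
have E : f @` `[0, 1] `&` G = f @` `[0, 1].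
  by apply: cA; [exists x | exists G | exists G].
by move: fz; rewrite -E => -[].
Qed.

Lemma dist_boundary_le {R : realType} {n : nat} {G : set 'rV[R]_n} x w :
  boundary G w -> dist_boundary G x <= enorm (x - w).
Proof.
move=> bw; apply: ge_inf; last by exists w.
by exists 0 => _ [u _ <-]; exact: enorm_ge0.
Qed.

Lemma dist_boundary_ge {R : realType} {n : nat} {G : set 'rV[R]_n} x r :
  boundary G !=set0 ->
  (forall w, boundary G w -> r <= enorm (x - w)) -> r <= dist_boundary G x.
Proof.
move=> [w bw] h; apply: lb_le_inf; first by exists (enorm (x - w)), w.
by move=> _ [u bu <-]; exact: h.
Qed.

(** An open [G] contains a ball around [x], which misses the boundary. The ball
    is one of the sup norm, whence the comparison with the Euclidean norm. *)
Lemma dist_boundary_gt0 {R : realType} {n : nat} {G : set 'rV[R]_n} x :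
  open G -> boundary G !=set0 -> G x -> 0 < dist_boundary G x.
Proof.
move=> oG bG Gx.
have /nbhs_ballP[e /= e0 eG] : nbhs x G by exact: open_nbhs_nbhs.
apply: (lt_le_trans e0); apply: dist_boundary_ge => // w [_ niw].
rewrite leNgt; apply/negP => lt_e; apply: niw.
apply: open_nbhs_nbhs; split=> //; apply: eG.
by rewrite -ball_normE /ball_ /=; apply: le_lt_trans lt_e; exact: mx_norm_le_enorm.
Qed.

Lemma dist_boundary_lipschitz {R : realType} {n : nat} {G : set 'rV[R]_n} x y :
  boundary G !=set0 ->
  dist_boundary G y <= dist_boundary G x + enorm (x - y).
Proof.
move=> bG; rewrite -lerBlDr; apply: dist_boundary_ge => // w bw.
rewrite lerBlDr addrC enormBC; apply: le_trans (enorm_triangle y x w).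
exact: dist_boundary_le.
Qed.

(** * Additive triples and geodesics of the j-metric *)

(** With [a = |x - y|], [b = |y - z|], [c = |x - z| <= a + b] and
    [m = min (d y) (d z)], exponentiating additivity in the case [d x <= d y]
    gives [(d x + a) (m + b) = (d x + c) m <= (d x + a + b) m], so
    [b (d x + a) <= b m]. If [d y < d x], the product on the left is at least
    [1 + (a + b) / d y], too large to equal [1 + c / d x]. *)
Lemma j_additive_dist {R : realType} {n : nat} {G : set 'rV[R]_n} x y z :
  0 < dist_boundary G x -> 0 < dist_boundary G y ->
  dist_boundary G x <= dist_boundary G z -> y != z ->
  j_metric G x y + j_metric G y z = j_metric G x z ->
  dist_boundary G x + enorm (x - y) <= dist_boundary G z.
Proof.
set dx := dist_boundary G x; set dy := dist_boundary G y.
set dz := dist_boundary G z => dx0 dy0 xz yz.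
have dz0 : 0 < dz by exact: lt_le_trans xz.
have b0 : 0 < enorm (y - z).
  rewrite lt_def enorm_ge0 andbT; apply: contra_neq yz => /enorm_eq0/eqP.
  by rewrite subr_eq0 => /eqP.
have tri := enorm_triangle x y z.
have a0 := enorm_ge0 (x - y).
have c0 := enorm_ge0 (x - z).
rewrite /j_metric -/dx -/dy -/dz (min_idPl xz).
move: a0 b0 c0 tri; set a := enorm (x - y); set b := enorm (y - z).
set c := enorm (x - z) => a0 b0 c0 tri.
have pos u v : 0 <= u -> 0 < v -> 1 + u / v \is Num.pos.
  by move=> u0 v0; rewrite posrE ltr_pwDl // divr_ge0 // ltW.
have mxy : 0 < Num.min dx dy by rewrite lt_min dx0.
have myz : 0 < Num.min dy dz by rewrite lt_min dy0.
rewrite -lnM ?pos //; last exact: ltW.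
move/ln_inj; rewrite ?posrE ?mulr_gt0 -?posrE ?pos // ?(ltW b0) //.
move=> /(_ isT isT) E.
have [xy|yx] := leP dx dy.
  move: E; rewrite (min_idPl xy); set m := Num.min dy dz => E.
  have {}E : (dx + a) * (m + b) = (dx + c) * m.
    have dxn : dx != 0 by rewrite gt_eqF.
    have mn : m != 0 by rewrite gt_eqF.
    have -> : (dx + a) * (m + b) = (1 + a / dx) * (1 + b / m) * (dx * m).
      by field; rewrite dxn mn.
    by rewrite E; field.
  have mz : m <= dz by rewrite ge_min lexx orbT.
  apply: le_trans mz.
  rewrite -(ler_pM2r b0); have := ler_wpM2r (ltW myz) tri.
  rewrite -/m; nra.
exfalso; move: E; rewrite (min_idPr (ltW yx)) (min_idPl _); last first.
  exact: le_trans (ltW yx) xz.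
have ab0 : 0 < a + b by rewrite ltr_wpDl.
have H1 : c / dx <= (a + b) / dx by rewrite ler_pM2r // invr_gt0.
have H2 : (a + b) / dx < (a + b) / dy by rewrite ltr_pM2l // ltf_pV2.
have H3 : 0 <= (a / dy) * (b / dy) by rewrite mulr_ge0 // divr_ge0 // ltW.
move: H2; rewrite mulrDl; nra.
Qed.

(** By the intermediate value theorem a geodesic from [x] to [z] passes at any
    distance [r] from [z] with [0 < r <= |x - z|]. At such a point
    [j_additive_dist] gives [d x + |x - z| - r <= d z]; letting [r] be small
    yields [d x + |x - z| <= d z], and the Lipschitz property the converse. *)
Lemma j_geodesic_dist {R : realType} {n : nat} {G : set 'rV[R]_n} x z gamma :
  open G -> boundary G !=set0 ->
  j_geodesic_joining G x z gamma ->
  dist_boundary G x <= dist_boundary G z ->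
  dist_boundary G z = dist_boundary G x + enorm (x - z).
Proof.
move=> oG bG [[[cg gG] geo] g0 g1] xz; apply/le_anti.
rewrite dist_boundary_lipschitz //= leNgt; apply/negP => lt_dz.
have in01 t : (0 <= t <= 1) -> G (gamma t).
  by move=> t01; apply: gG; exists t => //=; rewrite in_itv.
have Gx : G x by rewrite -g0; apply: in01; rewrite lexx ler01.
(* Half the defect of the equality: small enough to contradict lt_dz. *)
pose r := (dist_boundary G x + enorm (x - z) - dist_boundary G z) / 2.
have r0 : 0 < r by rewrite /r; lra.
have rl : r <= enorm (x - z) by rewrite /r; have := enorm_ge0 (x - z); lra.
have cz : continuous (fun w : 'rV[R]_n => enorm (w - z)).
  move=> w; apply: (@continuous_comp _ _ _ (fun u : 'rV[R]_n => u - z) (@enorm R n) w).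
    by apply: continuousB => ?; [exact: id | exact: cst_continuous].
  exact: enorm_continuous.
have cf : {within `[0, 1], continuous (fun t => enorm (gamma t - z))}.
  move=> t; apply: (@continuous_comp (subspace (`[0, 1] : set R)) _ _ gamma
    (fun w => enorm (w - z))); [exact: cg | exact: cz].
have [|t] := IVT (v := r) ler01 cf.
  rewrite g0 g1 subrr enorm0 (min_idPr (enorm_ge0 _)) (max_idPl (enorm_ge0 _)).
  by rewrite ltW.
rewrite in_itv /= => t01 tr; have /andP[t0 t1] := t01.
have gz : gamma t != z.
  by apply: contra_eq_neq tr => ->; rewrite subrr enorm0 lt_eqF.
have := geo 0 t 1 (lexx _) t0 t1 (lexx _); rewrite g0 g1.
move/j_additive_dist => /(_ (dist_boundary_gt0 _ oG bG Gx)).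
move=> /(_ (dist_boundary_gt0 _ oG bG (in01 _ t01)) xz gz).
have := enorm_triangle x (gamma t) z; rewrite tr /r; lra.
Qed.

(** * No isometry from an open set to the line *)

(** The witnesses are two vertices of a right isosceles triangle with legs of
    length [s] along two coordinate axes; no three reals have its distances. *)
Lemma open_no_isometry {R : realType} {n : nat} (G : set 'rV[R]_n)
    (d : 'rV[R]_n -> R) : (2 <= n)%N -> open G -> G !=set0 ->
  exists x y, [/\ G x, G y & `|d x - d y| != enorm (x - y)].
Proof.
move=> n2 oG [p Gp]; apply: contrapT => nex.
have iso x y : G x -> G y -> (d x - d y) ^+ 2 = enorm (x - y) ^+ 2.
  move=> Gx Gy; rewrite -real_normK ?num_real //; congr (_ ^+ 2).
  by apply/eqP/negPn/negP => ne; apply: nex; exists x, y.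
pose i := Ordinal (ltnW n2); pose j := Ordinal n2.
have /nbhs_ballP[e /= e0 eG] : nbhs p G by exact: open_nbhs_nbhs.
pose s := e / 2; have s0 : 0 < s by rewrite divr_gt0.
have Gs k : G (p + s *: delta_mx ord0 k).
  apply: eG; rewrite -ball_normE /ball_ /= opprD addNKr normrN.
  rewrite [X in X < _]mx_normrE; apply: bigmax_lt => // -[? l] _ /=.
  rewrite !mxE ger0_norm ?mulr_ge0 ?ler0n ?ltW // /s.
  by case: (_ && _); rewrite ?mulr1 ?mulr0 //; lra.
have ij : i != j by [].
have leg k l :
    k != l -> enorm (s *: delta_mx ord0 k : 'rV[R]_n) ^+ 2 = s ^+ 2.
  by move=> /(enorm_delta2 _ _ s 0); rewrite scale0r subr0 expr0n addr0.
have := iso _ _ (Gs i) (Gs j).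
rewrite opprD addrACA subrr add0r enorm_delta2 // => dij.
have := iso _ _ (Gs i) Gp; rewrite addrAC subrr add0r (leg i j) // => di.
have := iso _ _ Gp (Gs j).
rewrite opprD addNKr enormN (leg j i) // => dj.
have s2 : 0 < s ^+ 2 by rewrite exprn_gt0.
set u := d _ - d p in di.
set v := d p - d _ in dj.
have uv0 : u * v = 0.
  have E : (u + v) ^+ 2 = s ^+ 2 + s ^+ 2 by rewrite -dij /u /v subrKA.
  by move: E; rewrite sqrrD di dj; lra.
by move/eqP: uv0; rewrite -sqrf_eq0 exprMn di dj mulf_eq0 gt_eqF.
Qed.

Theorem theorem2p10 (R : realType) (n : nat) (hn : (2 <= n)%N)
    (G : set 'rV[R]_n) (hG : domain G) (hGT : G `<` [set: 'rV[R]_n]) :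
  exists x y : 'rV[R]_n, [/\ G x, G y &
    ~ exists gamma : R -> 'rV[R]_n, j_geodesic_joining G x y gamma].
Proof.
have [G0 oG _] := hG.
have bG : boundary G !=set0.
  by apply: boundary_nonempty => //; move: hGT; rewrite properEneq => -[].
have [x [y [Gx Gy ne]]] := open_no_isometry G (dist_boundary G) hn oG G0.
wlog xy : x y Gx Gy ne / dist_boundary G x <= dist_boundary G y.
  move=> H; have [/H|/ltW/H] := leP (dist_boundary G x) (dist_boundary G y).
    exact.
  by apply=> //; rewrite distrC enormBC.
exists x, y; split=> // -[gamma geo]; move/eqP: ne; apply.
by rewrite (j_geodesic_dist x y gamma) // opprD addNKr normrN ger0_norm ?enorm_ge0.
Qed.
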